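(* Let $\vartheta$ be a regular cardinal, and assume that either (A) there is no $\subsetneq^*$-decreasing chain of length $\vartheta$ in $\mathcal{P}(\omega)$, or (B) $\mathfrak{s}\le\vartheta$. Then there is a base matrix of height $\vartheta$.
   Context: For $A,B\subseteq\omega$, write $A\subseteq^* B$ if $A\setminus B$ is finite, and $A\subsetneq^* B$ if $A\subseteq^* B$ and $B\setminus A$ is infinite. A $\subsetneq^*$-decreasing chain of length $\vartheta$ is a family $\{A_\gamma:\gamma<\vartheta\}$ of subsets of $\omega$ with $A_\delta\subsetneq^* A_\gamma$ for all $\gamma<\delta<\vartheta$. $A$ splits $B$ (for infinite $A,B\subseteq\omega$) if $A\cap B$ and $B\setminus A$ are both infinite; a splitting family is a family $\mathcal{X}$ of infinite subsets of $\omega$ such that every infinite $B\subseteq\omega$ is split by some member of $\mathcal{X}$; the splitting number $\mathfrak{s}$ is the least size of a splitting family. A mad family is a maximal family of pairwise almost disjoint infinite subsets of $\omega$. A family $\mathcal{A}$ refines $\mathcal{B}$ if every $A\in\mathcal{A}$ satisfies $A\subseteq^* B$ for some $B\in\mathcal{B}$. A distributivity matrix of height $\vartheta$ is a collection $\{\mathcal{A}_\gamma:\gamma<\vartheta\}$ of mad families such that $\mathcal{A}_\delta$ refines $\mathcal{A}_\gamma$ whenever $\gamma\le\delta<\vartheta$, and no mad family refines all the $\mathcal{A}_\gamma$. It is a base matrix if moreover for every infinite $B\subseteq\omega$ there are $\gamma<\vartheta$ and $A\in\mathcal{A}_\gamma$ with $A\subseteq^* B$.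
   Formalization: The formal theorem assumes in addition that ϑ is at most the continuum; for regular ϑ above the continuum (A) and (B) both hold but no base matrix of height ϑ exists. *)

(* Defs.v *)
From mathcomp Require Import all_boot all_order.
From mathcomp Require Import boolp classical_sets functions cardinality.

Set Implicit Arguments.
Unset Strict Implicit.
Unset Printing Implicit Defensive.

Import Order.TTheory.
Local Open Scope classical_set_scope.
Local Open Scope card_scope.
Local Open Scope order_scope.

Definition almost_subset (A B : set nat) : Prop := finite_set (A `\` B).

Definition almost_ssubset (A B : set nat) : Prop :=
  almost_subset A B /\ infinite_set (B `\` A).

Definition splits (A B : set nat) : Prop :=
  infinite_set (A `&` B) /\ infinite_set (B `\` A).

Definition splitting_family (X : set (set nat)) : Prop :=
  (forall A, X A -> infinite_set A) /\
  (forall B, infinite_set B -> exists2 A, X A & splits A B).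

(* The splitting number is the cardinality of any family S with this property;
   the cardinals are represented by sets compared with #<=. *)
Definition realizes_splitting_number (S : set (set nat)) : Prop :=
  splitting_family S /\ forall X, splitting_family X -> S #<= X.

Definition splitting_number_le (T : Type) : Prop :=
  exists2 S, realizes_splitting_number S & S #<= [set: T].

Definition almost_disjoint_family (F : set (set nat)) : Prop :=
  (forall A, F A -> infinite_set A) /\
  (forall A B, F A -> F B -> A <> B -> finite_set (A `&` B)).

Definition mad_family (F : set (set nat)) : Prop :=
  almost_disjoint_family F /\
  (forall G, almost_disjoint_family G -> F `<=` G -> G = F).

Definition refines (F G : set (set nat)) : Prop :=
  forall A, F A -> exists2 B, G B & almost_subset A B.

(* A cardinal is an initial ordinal, and an ordinal theta is represented by a
   well-ordered type T of that order type, so that the elements of T play the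
   role of the ordinals below theta. *)
Section Height.
Context {d : Order.disp_t} (T : orderType d).

Definition is_cardinal : Prop :=
  well_founded (fun x y : T => x < y) /\
  (forall x : T, ~ ([set: T] #<= [set y : T | y < x])).

Definition cofinal (X : set T) : Prop := forall x : T, exists2 y, X y & x <= y.

Definition regular_cardinal : Prop :=
  [/\ is_cardinal, infinite_set [set: T]
    & forall X : set T, cofinal X -> [set: T] #<= X].

Definition decreasing_chain (C : T -> set nat) : Prop :=
  forall x y : T, x < y -> almost_ssubset (C y) (C x).

Definition distributivity_matrix (M : T -> set (set nat)) : Prop :=
  [/\ forall x, mad_family (M x),
      forall x y : T, x <= y -> refines (M y) (M x)
    & ~ exists2 F, mad_family F & forall x, refines F (M x)].

Definition base_matrix (M : T -> set (set nat)) : Prop :=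
  distributivity_matrix M /\
  (forall B, infinite_set B ->
    exists x : T, exists2 A, M x A & almost_subset A B).

End Height.

Lemma almost_subset_trans A B C :
  almost_subset A B -> almost_subset B C -> almost_subset A C.
Proof.
move=> AB BC; apply: (@sub_finite_set _ _ ((A `\` B) `|` (B `\` C))).
  by move=> n [An nC]; have [Bn|nB] := pselect (B n); [right|left].
by rewrite finite_setU.
Qed.

Lemma mad_family_neq0 F : mad_family F -> F !=set0.
Proof.
move=> [_ maxF]; apply/set0P/negP => /eqP F0.
have : [set [set: nat]] = F.
  apply: maxF; last by rewrite F0.
  by split=> [A -> | A B -> ->//]; exact: infinite_nat.
by rewrite F0 => /seteqP[/(_ setT erefl)].
Qed.

Lemma infinite_set_halve (A : set nat) : infinite_set A ->
  exists B, [/\ B `<=` A, infinite_set B & infinite_set (A `\` B)].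
Proof.
move=> /infiniteP/pcard_leP[f].
have fA n : A (f n) by exact: (@funS _ _ _ _ f n I).
have fI : injective f by move=> m n; apply: (@inj _ _ _ f); rewrite in_setT.
have img (g : nat -> nat) : injective g -> infinite_set (range g).
  move=> gI; apply/infiniteP; rewrite (card_le_eqr (inj_card_eq (in2W gI))).
  exact: card_lexx.
have dI : injective (fun n => f n.*2) by move=> m n /fI; exact: double_inj.
exists (range (fun n => f n.*2)); split; first by move=> _ [n _ <-].
  exact: img.
have d1I : injective (fun n => f n.*2.+1).
  by move=> m n /fI[] /double_inj.
apply: sub_infinite_set (img _ d1I) => _ [n _ <-]; split=> // -[m _ /fI].
by move/(congr1 odd); rewrite /= !odd_double.
Qed.

(* The height of a base matrix is at most the continuum. Both alternatives of
   the main theorem hold for every regular theta above the continuum, so its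
   hypothesis that theta is at most the continuum cannot be dropped. *)
Lemma base_matrix_le_continuum (d : Order.disp_t) (T : orderType d)
    (M : T -> set (set nat)) :
  regular_cardinal T -> base_matrix M -> [set: T] #<= [set: set nat].
Proof.
move=> [_ Tinf regT] [[madM refM _] baseM].
have [t0 _] := infinite_setN0 Tinf.
have [g gP] : {g : set nat -> T & forall B, infinite_set B ->
    exists2 A, M (g B) A & almost_subset A B}.
  apply: (@choice _ _ (fun B x => infinite_set B ->
    exists2 A, M x A & almost_subset A B)) => B.
  have [/baseM[x Hx]|nB] := pselect (infinite_set B); first by exists x.
  by exists t0.
apply: card_le_trans (card_image_le g setT); apply: regT.
apply: contrapT => /existsNP[x xN].
have gx B : g B <= x.
  have [//|xB] := leP (g B) x.
  by exfalso; apply: xN; exists (g B); [exists B|exact: ltW].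
have [A MA] := mad_family_neq0 (madM x).
have [[infM _] _] := madM x.
have [B [BA Binf ABinf]] := infinite_set_halve (infM _ MA).
have [C MC CB] := gP _ Binf.
have [C' MC' AC'] := refM _ _ (gx B) _ MA.
have [[infg adg] _] := madM (g B).
have CA : almost_subset C A.
  by apply: sub_finite_set CB => n [Cn nA]; split=> // /BA.
have [CC'|CC'] := pselect (C = C').
  by apply: ABinf; move: CB; rewrite CC'; exact: almost_subset_trans.
apply: (infg _ MC); rewrite -(setUIDK C C').
by rewrite finite_setU; split; [exact: adg|exact: almost_subset_trans AC'].
Qed.

(* Main.v *)
Require Import Defs.
From mathcomp Require Import all_boot all_order.
From mathcomp Require Import boolp classical_sets functions cardinality.
From mathcomp Require wochoice.

(* The matrix is built by recursion on the level [x].  A set born at level [y]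
   carries a label and stays in the matrix up to that level; afterwards it is
   replaced by sets below it which are one step further along a relation [R],
   chosen so that no infinite set lies below [R]-steps made cofinally often: a
   cofinal sequence of strict almost-inclusions would be a decreasing chain
   (case A), and steps deciding the least member of a splitting family that
   splits the current set would exhaust that family (case B).

   The families stay mad at limits because of the labels.  If no infinite subset
   of [X] has all levels below some bound above it, repeated splitting gives a
   binary tree of subsets of [X], hence, at a level [x] below the bound, continuum
   many sets in [X] which are separated by the previous levels.  A transfinite
   recursion of length continuum then lets the family at level [x] contain, for
   every such [X] and every label, a subset of [X] with that label; the one
   labelled by the bound survives up to it.  The same subset shows that the
   matrix is a base, and a base with the refinement property has no common
   refinement. *)

Set Implicit Arguments.
Unset Strict Implicit.
Unset Printing Implicit Defensive.

Import Order.TTheory.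
Local Open Scope classical_set_scope.
Local Open Scope card_scope.

(** * Well-founded recursion and choice *)

Lemma well_founded_min (T : Type) (lt : T -> T -> Prop) (P : T -> Prop) :
  well_founded lt -> (exists x, P x) ->
  exists2 x, P x & forall y, lt y x -> ~ P y.
Proof.
move=> wf [x0]; apply: contraPP => nomin.
elim/(well_founded_ind wf): x0 => x IH Px; apply: nomin.
by exists x => // y yx; exact: IH.
Qed.

Lemma well_founded_choice (T S : Type) (lt : T -> T -> Prop) (v0 : S)
    (Spec : T -> (T -> S) -> S -> Prop) : well_founded lt ->
  (forall x p q v, (forall y, lt y x -> p y = q y) ->
    Spec x p v -> Spec x q v) ->
  (forall x p, (forall y, lt y x -> Spec y p (p y)) -> exists v, Spec x p v) ->
  exists p, forall x, Spec x p (p x).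
Proof.
move=> wf loc ex.
(* [Spec] takes total functions, so a function on the predecessors of [x] is extended by the default
   [v0]; by [loc] the values elsewhere do not matter. *)
pose ext x (p : forall y, lt y x -> S) y :=
  if pselect (lt y x) is left h then p y h else v0.
pose F x (p : forall y, lt y x -> S) :=
  if pselect (exists v, Spec x (@ext x p) v) is left h then projT1 (cid h)
  else v0.
pose g := Fix wf (fun=> S) F.
have gE x : g x = F x (fun y _ => g y).
  apply: Fix_eq => {}x p q pq; congr F.
  by apply: functional_extensionality_dep => y; apply: funext => h; exact: pq.
have extE x y : lt y x -> @ext x (fun y _ => g y) y = g y.
  by rewrite /ext; case: pselect.
exists g; elim/(well_founded_ind wf) => x IH.
apply: (loc _ (@ext x (fun y _ => g y))); first exact: extE.
rewrite gE /F; case: pselect => [h|nex]; first exact: projT2 (cid h).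
exfalso; apply: nex; have [v hv] := ex x g IH; exists v.
by apply: loc hv => y yx; rewrite extE.
Qed.

Lemma well_ordered_type (K : eqType) : exists lt : K -> K -> Prop,
  well_founded lt /\ forall x y, x <> y -> lt x y \/ lt y x.
Proof.
have [R woR] := wochoice.well_ordering_principle K.
exists (fun x y => R x y /\ x <> y); split.
  move=> x; apply: contrapT => nx.
  have [z [[/asboolP nz lz] _]] :=
    woR [pred y | `[< ~ Acc (fun x y => R x y /\ x <> y) y >]]
      (ex_intro _ x (asboolT nx)).
  apply: nz; constructor=> y [yz neq].
  have [//|ny] := pselect (Acc (fun x y => R x y /\ x <> y) y).
  exfalso.
  have zy : R z y := lz y (asboolT ny).
  (* Antisymmetry of [R] comes from the uniqueness of minima: once singletons give reflexivity, [y]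
     and [z] are both least in the pair. *)
  have yyz : y \in pred2 y z by rewrite inE eqxx.
  have [m [_ um]] := woR _ (ex_intro _ y yyz).
  have Rr w : R w w.
    have ww : w \in pred1 w by rewrite inE.
    have [m' [[/eqP <- +] _]] := woR _ (ex_intro _ w ww).
    by apply; exact/eqP.
  have my : m = y by apply: um; split=> // w /orP[]/eqP->.
  have mz : m = z by apply: um; split=> [|w /orP[]/eqP->//]; apply/orP; right.
  by apply: neq; rewrite -my.
move=> x y xy; have xxy : x \in pred2 x y by rewrite inE eqxx.
have [m [[+ lm] _]] := woR _ (ex_intro _ x xxy).
move=> /orP[]/eqP mE; [left|right]; split=> //; last exact: nesym.
  by rewrite -mE; apply: lm; rewrite inE eqxx orbT.
by rewrite -mE; apply: lm; rewrite inE eqxx.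
Qed.

(* Transfinite recursion along a well-order of [K] all of whose proper initial
   segments are smaller than [K]; [h] indexes the elements of [K] by an initial
   segment with this property. *)
Lemma injective_choice (K : eqType) (J : Type) (j0 : J) (P : K -> Prop)
    (phi : K -> K -> J) :
  (forall i, P i -> injective (phi i)) ->
  exists a : K -> J, (forall i, P i -> exists k, a i = phi i k) /\
    (forall i j, P i -> P j -> a i = a j -> i = j).
Proof.
move=> phiI; have [lt [wf tot]] := well_ordered_type K.
pose big x := exists2 h : K -> K, injective h & forall i, lt (h i) x.
have [h hI hsmall] : exists2 h : K -> K, injective h & forall i, ~ big (h i).
  have [/(well_founded_min wf)[x [h hI hx] xmin]|nobig] :=
    pselect (exists x, big x).
    by exists h => // i; exact/xmin/hx.
  by exists id => // i hi; apply: nobig; exists i.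
pose Spec x (p : K -> J) v := forall i, h i = x -> P i ->
  (exists k, v = phi i k) /\ forall y, lt y x -> p y <> v.
have [||b bP] := @well_founded_choice _ _ lt j0 Spec wf.
- move=> x p q v pq pP i hi Pi; have [? vp] := pP i hi Pi; split=> // y yx.
  by rewrite -pq//; exact: vp.
- move=> x p _; have [[i [hi Pi]]|no] := pselect (exists i, h i = x /\ P i).
    suff [k kP] : exists k, forall y, lt y x -> p y <> phi i k.
      exists (phi i k) => j hj Pj; rewrite (hI j i) ?hi//.
      by split=> //; exists k.
    (* If every candidate [phi i k] were already taken, sending [k] to a place where it was used
       would inject [K] below [h i]. *)
    apply: contrapT => nk; apply: (hsmall i).
    have [g gP] : {g & forall k, lt (g k) x /\ p (g k) = phi i k}.
      apply: (@choice _ _ (fun k y => lt y x /\ p y = phi i k)) => k.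
      apply: contrapT => ny; apply: nk; exists k => y yx pE.
      by apply: ny; exists y.
    exists g; last by move=> k; rewrite hi; exact: (gP k).1.
    move=> k l gkl; apply: (phiI i Pi).
    by rewrite -(gP k).2 -(gP l).2 gkl.
  by exists j0 => i hi Pi; exfalso; apply: no; exists i.
exists (b \o h); split=> [i Pi|i j Pi Pj /= bE].
  exact: (bP _ _ erefl Pi).1.
apply: contrapT => ij; have [|hl|hl] := tot (h i) (h j); first by move/hI.
- exact: (bP _ _ erefl Pj).2 hl bE.
- exact: (bP _ _ erefl Pi).2 hl (esym bE).
Qed.

(** * Almost inclusion and almost disjoint families *)

Lemma almost_subset_sub A B : A `<=` B -> almost_subset A B.
Proof.
move=> AB; rewrite /almost_subset (_ : _ `\` _ = set0); first exact: finite_set0.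
by rewrite -subset0 => n [/AB].
Qed.

Lemma almost_subset_infiniteI A B C :
  almost_subset A B -> infinite_set (A `&` C) -> infinite_set (B `&` C).
Proof.
move=> AB; apply: contra_not => BC.
apply: (@sub_finite_set _ _ ((A `\` B) `|` (B `&` C))); last first.
  by rewrite finite_setU.
by move=> n [An Cn]; have [Bn|nB] := pselect (B n); [right|left].
Qed.

Lemma infinite_setI_or T (A B : set T) : infinite_set A ->
  infinite_set (A `&` B) \/ infinite_set (A `\` B).
Proof.
move=> Ainf; have [AB|AB] := pselect (finite_set (A `\` B)); last by right.
left=> AIB; apply: Ainf; rewrite -(setUIDK A B).
by rewrite finite_setU.
Qed.

Section AlmostDisjoint.
Context (F : set (set nat)) (adF : almost_disjoint_family F).

Lemma almost_disjoint_eq A B : F A -> F B -> infinite_set (A `&` B) -> A = B.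
Proof. by move=> FA FB; apply: contra_notP; exact: adF.2. Qed.

Lemma almost_disjoint_above A B Y : F A -> F B -> infinite_set Y ->
  almost_subset Y A -> almost_subset Y B -> A = B.
Proof.
move=> FA FB Yinf YA YB; apply: almost_disjoint_eq => //.
apply: almost_subset_infiniteI YA _; rewrite setIC.
by apply: almost_subset_infiniteI YB _; rewrite setIid.
Qed.

Lemma mad_familyI :
  (forall C, infinite_set C -> exists2 A, F A & infinite_set (A `&` C)) ->
  mad_family F.
Proof.
move=> hit; split=> // G adG FG; apply/seteqP; split=> // C GC.
have [A FA AC] := hit C (adG.1 _ GC).
suff -> : C = A by [].
by apply: contra_notP AC => CA; apply: adG.2 => //; [exact: FG|exact: nesym].
Qed.

End AlmostDisjoint.

Lemma almost_disjoint_setU F G :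
  almost_disjoint_family F -> almost_disjoint_family G ->
  (forall A B, F A -> G B -> finite_set (A `&` B)) ->
  almost_disjoint_family (F `|` G).
Proof.
move=> adF adG FG; split=> [A [/adF.1|/adG.1]//|A B [FA|GA] [FB|GB] AB].
- exact: adF.2.
- exact: FG.
- by rewrite setIC; exact: FG.
- exact: adG.2.
Qed.

Lemma mad_family_meets F C : mad_family F -> infinite_set C ->
  exists2 A, F A & infinite_set (A `&` C).
Proof.
move=> [adF maxF] Cinf; apply: contrapT => nohit.
have fin A : F A -> finite_set (A `&` C).
  by move=> FA; apply: contrapT => AC; apply: nohit; exists A.
have FC : F C.
  rewrite -(maxF (F `|` [set C])); [by right| |exact: subsetUl].
  apply: almost_disjoint_setU => //; last by move=> A _ FA ->; exact: fin.
  by split=> [A ->|A B -> ->].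
by apply: Cinf; rewrite -(setIid C); exact: fin.
Qed.

(** By Zorn, take a maximal admissible [N]; an infinite set almost disjoint from all members of [N]
    and [F] would contain an infinite member of [E] that could be added to [N]. *)
Lemma almost_disjoint_extend F E : almost_disjoint_family F ->
  (forall X, infinite_set X -> exists B, [/\ E B, infinite_set B & B `<=` X]) ->
  exists2 N, N `<=` E & mad_family (N `|` F).
Proof.
move=> adF dense.
pose P N := N `<=` E /\ almost_disjoint_family (N `|` F).
have [C CP totC|N [[NE adN] maxN]] := @Zorn_bigcup _ P.
  split; first by move=> A [N CN NA]; exact: (CP _ CN).1.
  split=> [A [[N CN NA]|FA]|A B]; first by apply: (CP _ CN).2.1; left.
  - exact: adF.1.
  - move=> [[N CN NA]|FA] [[N' CN' NB]|FB].
    + have [NN|NN] := totC _ _ CN CN'.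
        by apply: (CP _ CN').2.2; left=> //; exact: NN.
      by apply: (CP _ CN).2.2; left=> //; exact: NN.
    + by apply: (CP _ CN).2.2; [left|right].
    + by apply: (CP _ CN').2.2; [right|left].
    + exact: adF.2.
exists N => //; apply: mad_familyI => // C Cinf; apply: contrapT => nohit.
have [B [EB Binf BC]] := dense C Cinf.
have fin A : (N `|` F) A -> finite_set (A `&` B).
  move=> NFA; apply: contrapT => AB; apply: nohit; exists A => //.
  by apply: sub_infinite_set AB; exact: setIS.
apply: (maxN (N `|` [set B])).
  split; first exact: subsetUl.
  move=> NB; have {}NB : N B by apply: NB; right.
  by apply: Binf; rewrite -(setIid B); apply: fin; left.
split; first by move=> A [/NE//|->].
rewrite setUAC; apply: almost_disjoint_setU => //.
  by split=> [A ->|A A' -> ->].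
by move=> A _ NA ->; exact: fin.
Qed.

(** A diagonal choice of [g n] in [X n]; the demand [n <= g n] makes the range infinite without
    asking that [g] be injective. *)
Lemma pseudointersection (X : nat -> set nat) :
  (forall n, infinite_set (X n)) -> (forall n, X n.+1 `<=` X n) ->
  exists Z, [/\ infinite_set Z, Z `<=` X 0%N & forall n, almost_subset Z (X n)].
Proof.
move=> Xinf Xdec.
have Xmono m n : (m <= n)%N -> X n `<=` X m.
  move=> /subnK <-; elim: (n - m)%N => // k IH.
  by rewrite addSn; exact: subset_trans (Xdec _) IH.
have [g gP] : {g : nat -> nat & forall n, X n (g n) /\ (n <= g n)%N}.
  apply: (@choice _ _ (fun n m => X n m /\ (n <= m)%N)) => n.
  apply: contrapT => no; apply: (Xinf n).
  apply: (@sub_finite_set _ _ `I_n); last exact: finite_II.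
  by move=> m Xm /=; rewrite ltnNge; apply/negP => nm; apply: no; exists m.
exists (range g); split.
- move=> /finite_seqP[s sE].
  have : [set` s] (g (\max_(i <- s) i).+1).
    by rewrite -sE; exists (\max_(i <- s) i).+1.
  move=> /= gs; have := @leq_bigmax_seq _ s xpredT id _ gs isT.
  by rewrite leqNgt (leq_trans _ (gP _).2).
- by move=> _ [n _ <-]; exact: (Xmono 0%N n) (gP n).1.
- move=> n; apply: (@sub_finite_set _ _ (g @` `I_n)).
    move=> _ [[m _ <-] nX]; exists m => //=; rewrite ltnNge; apply/negP => nm.
    by apply: nX; exact: Xmono nm _ (gP m).1.
  exact/finite_image/finite_II.
Qed.

(** * Mad families with labelled subsets of rich sets *)

(* A mad family contained in [E `|` F] has continuum many members in [E] which
   meet [X]: the members meeting the various [Z f] are distinct. *)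
Definition rich (F E : set (set nat)) (X : set nat) : Prop :=
  exists Z : set nat -> set nat,
  [/\ forall f, infinite_set (Z f) /\ Z f `<=` X,
      forall f A, F A -> finite_set (A `&` Z f)
    & forall f g B, E B -> infinite_set (B `&` Z f) ->
        infinite_set (B `&` Z g) -> f = g].

(** Extend [F] to a mad family; each rich [X] then meets continuum many new members. There are at
    most continuum many pairs of [X] and [t], so each pair can reserve a member of its own, and
    cutting it down to [X] yields the set with label [t]. *)
Lemma labelled_mad_family (T : Type) (t0 : T) (code : T -> set nat)
    (F E : set (set nat)) :
  injective code -> almost_disjoint_family F ->
  (forall B B', E B -> infinite_set B' -> B' `<=` B -> E B') ->
  (forall X, infinite_set X -> exists B, [/\ E B, infinite_set B & B `<=` X]) ->
  exists N (l : set nat -> T), [/\ N `<=` E, mad_family (N `|` F) &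
    forall X t, rich F E X -> exists B, [/\ N B, B `<=` X & l B = t]].
Proof.
move=> codeI adF Edown dense.
have [N' N'E madN'] := almost_disjoint_extend adF dense.
(* Pairs are coded as sets of naturals, on even and odd positions, so that tasks and candidates are
   indexed by the same type, as [injective_choice] requires. *)
pose task (X : set nat) (t : T) : set nat :=
  [set n | if odd n then code t n./2 else X n./2].
have taskI X t X' t' : task X t = task X' t' -> X = X' /\ t = t'.
  move=> e; split.
    apply/funext => n; have := congr1 (fun S : set nat => S n.*2) e.
    by rewrite /task /mkset odd_double doubleK.
  apply: codeI; apply/funext => n.
  have := congr1 (fun S : set nat => S n.*2.+1) e.
  by rewrite /task /mkset /= odd_double /= uphalf_double.
have phiP X : rich F E X -> exists phi : set nat -> set nat, injective phi /\
    forall f, (N' `\` F) (phi f) /\ infinite_set (phi f `&` X).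
  move=> [Z [Zinf ZF ZE]].
  have [phi hphi] : {phi & forall f, (N' `\` F) (phi f) /\
      infinite_set (phi f `&` Z f)}.
    apply: (@choice _ _ (fun f A => (N' `\` F) A /\ infinite_set (A `&` Z f))) => f.
    have [A [N'A|FA] AZ] := mad_family_meets madN' (Zinf f).1; last first.
      by exfalso; exact/AZ/ZF.
    by exists A; split=> //; split=> // /ZF.
  exists phi; split=> [f g fg|f].
    apply: (ZE f g (phi f)); [exact/N'E/(hphi f).1.1|exact: (hphi f).2|].
    by rewrite fg; exact: (hphi g).2.
  split; first exact: (hphi f).1.
  by apply: sub_infinite_set (hphi f).2; apply: setIS; exact: (Zinf f).2.
pose P (i : set nat) := exists X t, i = task X t /\ rich F E X.
have [phi hphi] : {phi : set nat -> set nat -> set nat &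
    forall i, P i -> injective (phi i) /\ forall X t, i = task X t ->
      forall f, (N' `\` F) (phi i f) /\ infinite_set (phi i f `&` X)}.
  apply: (@choice _ _ (fun i (h : set nat -> set nat) => P i ->
    injective h /\ forall X t, i = task X t ->
      forall f, (N' `\` F) (h f) /\ infinite_set (h f `&` X))) => i.
  have [[X [t [-> Xr]]]|nP] := pselect (P i); last by exists id.
  have [h [hI hP]] := phiP X Xr; exists h => _; split=> // X' t' /taskI[<- _].
  exact: hP.
have [a [aP aI]] := injective_choice set0 (fun i hi => (hphi i hi).1).
have aX X t : rich F E X ->
    (N' `\` F) (a (task X t)) /\ infinite_set (a (task X t) `&` X).
  move=> Xr; have Pt : P (task X t) by exists X, t.
  by have [k ->] := aP _ Pt; exact: (hphi _ Pt).2.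
pose N1 := [set B | exists X t, rich F E X /\ B = a (task X t) `&` X].
have N1eq X t X' t' : rich F E X -> rich F E X' ->
    infinite_set ((a (task X t) `&` X) `&` (a (task X' t') `&` X')) ->
    X = X' /\ t = t'.
  move=> Xr X'r inf; apply: taskI; apply: aI; [by exists X, t|by exists X', t'|].
  apply: (almost_disjoint_eq madN'.1).
  - by left; exact: (aX X t Xr).1.1.
  - by left; exact: (aX X' t' X'r).1.1.
  - by apply: sub_infinite_set inf => n [[? _] [? _]].
have adN1 : almost_disjoint_family N1.
  split=> [_ [X [t [Xr ->]]]|_ _ [X [t [Xr ->]]] [X' [t' [X'r ->]]]].
    exact: (aX X t Xr).2.
  by apply: contra_notP => /N1eq-/(_ Xr X'r)[-> ->].
have adFN1 : almost_disjoint_family (F `|` N1).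
  apply: almost_disjoint_setU => // A _ FA [X [t [Xr ->]]].
  apply: contrapT => inf; have [[N'a nFa] _] := aX X t Xr; apply: nFa.
  suff <- : A = a (task X t) by [].
  apply: (almost_disjoint_eq madN'.1); [by right|by left|].
  by apply: sub_infinite_set inf => n [? []].
(* Keeping only the traces of the reserved members may destroy maximality, which a second extension
   restores. *)
have [N2 N2E madN2] := almost_disjoint_extend adFN1 dense.
(* The label can be read off [B]: by [N1eq] an infinite trace determines its task. Sets that are no
   trace get [t0]. *)
exists (N2 `|` N1), (fun B => if pselect (exists t X, rich F E X /\
  B = a (task X t) `&` X) is left h then projT1 (cid h) else t0); split.
- move=> B [/N2E//|[X [t [Xr ->]]]]; have [[/N'E Ea _] inf] := aX X t Xr.
  by apply: Edown Ea inf _; exact: subIsetl.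
- by rewrite -setUA (setUC N1).
- move=> X t Xr; exists (a (task X t) `&` X); split.
  + by right; exists X, t.
  + exact: subIsetr.
  + case: pselect => [h|]; last by case; exists t, X.
    case: (cid h) => t' /= [X' [X'r e]]; have [] := N1eq X t X' t' Xr X'r => //.
    by rewrite -e setIid; exact: (aX X t Xr).2.
Qed.

(** * The binary tree of splittings *)

(** Every infinite [Y] inside [X] is split by some level, for otherwise it would lie almost below a
    member at every level of [U]. Iterating gives a binary tree whose nodes of height [n] are all
    split at one level [u n]; [Z f] is a pseudointersection of the branch [f]. *)
Lemma splitting_tree (d : Order.disp_t) (T : orderType d)
    (M : T -> set (set nat)) (U : set T) (X : set nat) :
  (forall x, U x -> mad_family (M x)) ->
  (forall x y, U y -> (x <= y)%O -> refines (M y) (M x)) ->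
  infinite_set X ->
  (forall Y, infinite_set Y -> Y `<=` X ->
    ~ forall x, U x -> exists2 A, M x A & almost_subset Y A) ->
  exists (u : nat -> T) (Z : set nat -> set nat),
  [/\ [/\ forall n, U (u n), forall n, (u n <= u n.+1)%O &
          exists2 x, U x & forall n, (u n < x)%O],
      forall f, infinite_set (Z f) /\ Z f `<=` X,
      forall f g B, (forall n, exists2 A, M (u n) A & almost_subset B A) ->
        infinite_set (B `&` Z f) -> infinite_set (B `&` Z g) -> f = g &
      forall f n A, M (u n) A -> M (u n.+1) A -> finite_set (A `&` Z f)].
Proof.
move=> madM refM Xinf Xndeep.
pose split x (Y : set nat) (A : set nat * set nat) :=
  [/\ M x A.1, M x A.2, A.1 <> A.2, infinite_set (Y `&` A.1)
    & infinite_set (Y `&` A.2)].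
have splitex Y : infinite_set Y -> Y `<=` X ->
    exists2 x, U x & exists A, split x Y A.
  move=> Yinf YX; apply: contrapT => nosplit; apply: (Xndeep Y Yinf YX) => x Ux.
  have [A MA AY] := mad_family_meets (madM x Ux) Yinf; exists A => //.
  apply: contrapT => YA; have [B MB BYA] := mad_family_meets (madM x Ux) YA.
  apply: nosplit; exists x => //; exists (A, B); split=> //=.
  - move=> AB; apply: BYA; rewrite -AB (_ : _ `&` _ = set0).
      exact: finite_set0.
    by rewrite -subset0 => n [? []].
  - by rewrite setIC.
  - by rewrite setIC; apply: sub_infinite_set BYA; apply: setIS; exact: subDsetl.
have splitmono x y Y A : U y -> (x <= y)%O -> U x -> split x Y A ->
    exists B, split y Y B.
  move=> Uy xy Ux [/= MA MA' AA' YA YA'].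
  have up A0 : M x A0 -> infinite_set (Y `&` A0) ->
      exists B, [/\ M y B, infinite_set (Y `&` B) & almost_subset B A0].
    move=> MA0 YA0; have [B MB BYA] := mad_family_meets (madM y Uy) YA0.
    have [C MC BC] := refM _ _ Uy xy _ MB.
    exists B; split=> //.
      by rewrite setIC; apply: sub_infinite_set BYA; apply: setIS; exact: subIsetl.
    suff <- : C = A0 by [].
    apply: (almost_disjoint_eq (madM x Ux).1) => //.
    apply: almost_subset_infiniteI BC _.
    by apply: sub_infinite_set BYA; apply: setIS; exact: subIsetr.
  have [B [MB YB BA]] := up _ MA YA; have [B' [MB' YB' BA']] := up _ MA' YA'.
  exists (B, B'); split=> //= BB; apply: AA'.
  rewrite -BB in BA'.
  apply: (almost_disjoint_above (madM x Ux).1 _ _ _ BA BA') => //.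
  exact: (madM y Uy).1.1.
have [u0 Uu0] : U !=set0.
  by apply: contrapT => U0; apply: (Xndeep X Xinf) => // x Ux; case: U0; exists x.
pose good (L : seq (set nat)) := forall Y, Y \in L -> infinite_set Y /\ Y `<=` X.
pose allsplit x (L : seq (set nat)) := forall Y, Y \in L -> exists A, split x Y A.
(* A splitting persists at higher levels in [U], so the largest of finitely many levels splits the
   whole list. *)
have listsplit (L : seq (set nat)) x : U x -> good L ->
    exists y, [/\ U y, (x <= y)%O & allsplit y L].
  move=> Ux; elim: L => [_|Y L IH goodL]; first by exists x.
  have [|y [Uy xy spy]] := IH.
    by move=> Y' Y'L; apply: goodL; rewrite inE Y'L orbT.
  have [Yinf YX] := goodL Y (mem_head _ _).
  have [z Uz [A spA]] := splitex Y Yinf YX.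
  have [yz|zy] := leP y z.
    exists z; split=> //; first exact: le_trans xy yz.
    move=> Y'; rewrite inE => /predU1P[->|/spy[B spB]]; first by exists A.
    exact: splitmono Uz yz Uy spB.
  exists y; split=> // Y'; rewrite inE => /predU1P[->|/spy//].
  exact: splitmono Uy (ltW zy) Uz spA.
have [piece pieceP] : {piece : T * set nat -> set nat * set nat &
    forall p, (exists A, split p.1 p.2 A) -> split p.1 p.2 (piece p)}.
  apply: (@choice _ _ (fun p A => (exists A, split p.1 p.2 A) ->
    split p.1 p.2 A)) => p.
  have [[A spA]|no] := pselect (exists A, split p.1 p.2 A); first by exists A.
  by exists (set0, set0) => /no.
pose pc x Y (b : bool) :=
  Y `&` (if b then (piece (x, Y)).1 else (piece (x, Y)).2).
pose children x L := [seq pc x Y b | Y <- L, b <- [:: true; false]].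
pose inv (s : T * seq (set nat)) := [/\ U s.1, good s.2 & allsplit s.1 s.2].
have goodch s : inv s -> good (children s.1 s.2).
  move=> [Us gs ss] Z /allpairsP[[Y b] [/= YL _ ->]].
  have [Yinf YX] := gs Y YL; have [_ _ _ ? ?] := pieceP (s.1, Y) (ss Y YL).
  split; first by rewrite /pc; case: (b).
  by apply: subset_trans YX; exact: subIsetl.
have [next nextP] : {next : T * seq (set nat) -> T * seq (set nat) & forall s,
    inv s -> [/\ inv (next s), (s.1 <= (next s).1)%O &
              (next s).2 = children s.1 s.2]}.
  apply: (@choice _ _ (fun s r => inv s -> [/\ inv r, (s.1 <= r.1)%O &
              r.2 = children s.1 s.2])) => s.
  have [invs|ns] := pselect (inv s); last by exists s => /ns.
  have [|y [Uy sy spy]] := listsplit (children s.1 s.2) s.1 _ (goodch s invs).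
    by case: invs.
  by exists (y, children s.1 s.2) => _; split=> //; split=> //; exact: goodch.
have [|u1 [Uu1 _ sp1]] := listsplit [:: X] u0 Uu0.
  by move=> Y; rewrite inE => /eqP->; split.
pose st := fix st n := if n is n'.+1 then next (st n') else (u1, [:: X]).
have inv0 : inv (st 0%N).
  by split=> //= Y; rewrite inE => /eqP->; split.
have invst n : inv (st n) by elim: n => // n /nextP[].
pose u n := (st n).1.
pose W (f : set nat) := fix W n :=
  if n is n'.+1 then pc (u n') (W n') `[< f n' >] else X.
have WL f n : W f n \in (st n).2.
  elim: n => [|n IH] /=; first exact: mem_head.
  have [_ _ ->] := nextP _ (invst n).
  apply/allpairsP; exists (W f n, `[< f n >]); split=> //.
  by case: `[< _ >].
have Wsplit f n := pieceP (u n, W f n)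
  (let: And3 _ _ h := invst n in h _ (WL f n)).
have Winf f n : infinite_set (W f n).
  by have [_ gs _] := invst n; exact: (gs _ (WL f n)).1.
have Udec f n : W f n.+1 `<=` W f n by exact: subIsetl.
have Uu n : U (u n) by case: (invst n).
have umono n : (u n <= u n.+1)%O by have [] := nextP _ (invst n).
have WM f n : exists2 A, M (u n) A & W f n.+1 `<=` A.
  have [/= MA MA' _ _ _] := Wsplit f n.
  exists (if `[< f n >] then (piece (u n, W f n)).1 else (piece (u n, W f n)).2).
    by case: ifP.
  exact: subIsetr.
have [Z ZP] : {Z : set nat -> set nat & forall f, [/\ infinite_set (Z f),
    Z f `<=` X & forall n, almost_subset (Z f) (W f n)]}.
  apply: (@choice _ _ (fun f Y => [/\ infinite_set Y, Y `<=` X &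
    forall n, almost_subset Y (W f n)])) => f.
  exact: (pseudointersection (Winf f) (Udec f)).
have hitW f n B : infinite_set (B `&` Z f) -> infinite_set (B `&` W f n).
  move=> BZ; have [_ _ ZW] := ZP f; rewrite setIC.
  by apply: almost_subset_infiniteI (ZW n) _; rewrite setIC.
exists u, Z; split.
(* If the levels [u n] had no strict bound in [U], any [Z f], here [Z set0], would lie almost below
   a member at every level of [U]. *)
- split=> //; apply: contrapT => cof.
  have [Zinf ZX ZW] := ZP set0; apply: (Xndeep _ Zinf ZX) => x Ux.
  have [n xn] : exists n, (x <= u n)%O.
    apply: contrapT => no; apply: cof; exists x => // n.
    by rewrite ltNge; apply/negP => xn; apply: no; exists n.
  have [A MA WA] := WM set0 n; have [C MC AC] := refM _ _ (Uu n) xn _ MA.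
  exists C => //; apply: almost_subset_trans AC.
  exact: almost_subset_trans (ZW n.+1) (almost_subset_sub WA).
- by move=> f; have [] := ZP f.
- move=> f g B BM BZf BZg; apply: contrapT => fg.
  (* At the first [n] where [f] and [g] differ, the two branches leave a common node into different
     members of [M (u n)], while [B] is almost below only one member. *)
  have [|n /asboolP fgn nmin] := @ex_minnP (fun n => `[< ~ (f n <-> g n) >]).
    apply: contrapT => no; apply: fg; apply/funext => n; apply/propext.
    by apply: contrapT => fgn; apply: no; exists n; exact/asboolP.
  have Weq m : (m <= n)%N -> W f m = W g m.
    elim: m => // m IH mn /=; rewrite IH ?(ltnW mn)//; congr pc.
    by apply: asbool_equiv_eq; apply: contrapT => /asboolT/nmin; rewrite leqNgt mn.
  have [A MA BA] := BM n.
  have := hitW _ n.+1 _ BZf; have := hitW _ n.+1 _ BZg; rewrite /= -Weq//.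
  have [/= MA1 MA2 A12 _ _] := Wsplit f n.
  have toA C : M (u n) C -> infinite_set (B `&` (W f n `&` C)) -> A = C.
    move=> MC BC; apply: (almost_disjoint_eq (madM _ (Uu n)).1) => //.
    apply: almost_subset_infiniteI BA _; apply: sub_infinite_set BC.
    apply: setIS; exact: subIsetr.
  rewrite /pc; case: asboolP => gn; case: asboolP => fn h1 h2.
  + exact: fgn.
  + by apply: A12; rewrite -(toA _ MA1 h1) -(toA _ MA2 h2).
  + by apply: A12; rewrite -(toA _ MA1 h2) -(toA _ MA2 h1).
  + exact: fgn.
(* If [A] met [Z f] in an infinite set, it would be the member [C] containing the node [W f n.+1];
   but this node meets two distinct members at [u n.+1], and both would equal [A]. *)
- move=> f n A MA MA'; apply: contrapT => AZ.
  have [C MC WC] := WM f n.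
  have AC : A = C.
    apply: (almost_disjoint_eq (madM _ (Uu n)).1) => //.
    by apply: sub_infinite_set (hitW _ n.+1 _ AZ); exact: setIS.
  have [/= M1 M2 neq W1 W2] := Wsplit f n.+1; apply: neq.
  have toA D : M (u n.+1) D -> infinite_set (W f n.+1 `&` D) -> A = D.
    move=> MD WD; apply: (almost_disjoint_eq (madM _ (Uu n.+1)).1) => //.
    by rewrite AC; apply: sub_infinite_set WD; exact: setSI.
  by rewrite -(toA _ M1 W1) -(toA _ M2 W2).
Qed.

(** * Construction of the matrix from a relation [R] *)

Section Matrix.
Context (d : Order.disp_t) (T : orderType d).
Context (R : set nat -> set nat -> Prop).
Context (T_wf : well_founded (fun x y : T => (x < y)%O)).
Context (t0 : T) (code : T -> set nat) (codeI : injective code).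
Context (R_sub : forall A B B', R A B -> almost_subset B' B -> R A B').
Context (R_irr : forall A, ~ R A A).
Context (R_dense : forall A X, infinite_set X -> almost_subset X A ->
  exists B, [/\ R A B, infinite_set B & B `<=` X]).

Implicit Types (p : T -> set (set nat) * (set nat -> T)) (x y z : T).

(* Stage [x] consists of the sets born at [x] and of their labels; a set born
   at [y] stays in the matrix up to the level given by its label. *)
Definition frozen p x : set (set nat) :=
  [set A | exists y, [/\ (y < x)%O, (p y).1 A & (x <= (p y).2 A)%O]].

Definition level p x : set (set nat) := (p x).1 `|` frozen p x.

Definition refining p x : set (set nat) :=
  [set B | infinite_set B /\ forall y, (y < x)%O ->
    exists A, [/\ level p y A, almost_subset B A & R A B]].

Definition stage x p (v : set (set nat) * (set nat -> T)) : Prop :=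
  [/\ v.1 `<=` refining p x, mad_family (v.1 `|` frozen p x) &
      forall X t, rich (frozen p x) (refining p x) X ->
        exists B, [/\ v.1 B, B `<=` X & v.2 B = t]].

Lemma level_birth p x A : level p x A ->
  exists y, [/\ (y <= x)%O, (p y).1 A &
    forall z, (y <= z)%O -> (z <= x)%O -> level p z A].
Proof.
move=> [Ax|[y [yx Ay xl]]].
  exists x; split=> // z xz zx.
  by rewrite (@le_anti _ _ z x) ?zx ?xz//; left.
exists y; split=> //; first exact: ltW.
move=> z; rewrite le_eqVlt => /predU1P[<-|yz] zx; first by left.
by right; exists y; split=> //; exact: le_trans zx xl.
Qed.

Section Segment.
Context (p : T -> set (set nat) * (set nat -> T)) (U : set T).
Context (U_down : forall x y, U y -> (x <= y)%O -> U x).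
Context (pU : forall x, U x -> stage x p (p x)).

Lemma level_mad x : U x -> mad_family (level p x).
Proof. by case/pU. Qed.

Lemma born_below x y A : U y -> (x < y)%O -> (p y).1 A ->
  exists B, [/\ level p x B, almost_subset A B & R B A].
Proof. by move=> Uy xy; have [sub _ _] := pU Uy => /sub[_]; exact. Qed.

Lemma level_refines x y : U y -> (x <= y)%O -> refines (level p y) (level p x).
Proof.
move=> Uy xy A /level_birth[b [byy Ab alive]].
have [xb|bx] := ltP x b.
  by have [B [? ? _]] := born_below (U_down Uy byy) xb Ab; exists B.
by exists A; [exact: alive|exact: almost_subset_sub].
Qed.

(** Apply [splitting_tree] and let [x] be the least strict bound of the levels [u n]. By minimality
    a set frozen at [x] was born no later than some [u n], so it belongs to the levels [u n] and
    [u n.+1] and is almost disjoint from [Z f]. A refining set lies almost below a member of each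
    level [u n], so it has infinite intersection with at most one [Z f]. *)
Lemma rich_of_not_deep X : infinite_set X ->
  (forall Y, infinite_set Y -> Y `<=` X ->
    ~ forall x, U x -> exists2 A, level p x A & almost_subset Y A) ->
  exists2 x, U x & rich (frozen p x) (refining p x) X.
Proof.
move=> Xinf nd.
have [u [Z [[Uu umono [x1 Ux1 ux1]] ZX Zsep Zold]]] :=
  splitting_tree level_mad level_refines Xinf nd.
have [x [Ux ux] xmin] := @well_founded_min _ _
  (fun x => U x /\ forall n, (u n < x)%O) T_wf
  (ex_intro _ x1 (conj Ux1 ux1)).
exists x => //; exists Z; split=> // [f A [y [yx Ay xl]]|f g B [_ Bref]].
  have [n yn] : exists n, (y <= u n)%O.
    apply: contrapT => no; apply: (xmin y yx).
    split; first exact: U_down Ux (ltW yx).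
    by move=> n; rewrite ltNge; apply/negP => yn; apply: no; exists n.
  have alive m : (y <= u m)%O -> level p (u m) A.
    rewrite le_eqVlt => /predU1P[<-|ym]; first by left.
    by right; exists y; split=> //; exact: le_trans (ltW (ux m)) xl.
  exact: (Zold f n) (alive _ yn) (alive _ (le_trans yn (umono n))).
by apply: Zsep => n; have [A [? ? _]] := Bref (u n) (ux n); exists A.
Qed.

End Segment.

Section Stage.
Context (p : T -> set (set nat) * (set nat -> T)) (x : T).
Context (px : forall y, (y < x)%O -> stage y p (p y)).

Let U := [set y : T | (y < x)%O].
Let U_down y z : U z -> (y <= z)%O -> U y.
Proof. by rewrite /U /= => zx yz; exact: le_lt_trans yz zx. Qed.

(** Two frozen sets both belong to the level at which the later of them was born. *)
Lemma frozen_ad : almost_disjoint_family (frozen p x).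
Proof.
split=> [A [y [yx Ay _]]|A B [y [yx Ay xA]] [z [zx Bz xB]]].
  by have [[+ _] _] := level_mad px yx; apply; left.
have alive C w v : (p w).1 C -> (x <= (p w).2 C)%O -> (w <= v)%O -> (v < x)%O ->
    level p v C.
  move=> Cw xC; rewrite le_eqVlt => /predU1P[<-|wv] vx; first by left.
  by right; exists w; split=> //; exact: le_trans (ltW vx) xC.
have [yz|zy] := leP y z.
  apply: (level_mad px zx).1.2; first exact: alive Ay xA yz zx.
  by left.
apply: (level_mad px yx).1.2; first by left.
exact: alive Bz xB (ltW zy) yx.
Qed.

(** Otherwise [X] is rich at some [y] below [x], and its subset born there with label [x] belongs to
    every level from [y] up to [x], so it is itself such a [Y]. *)
Lemma deep_dense X : infinite_set X -> exists Y, [/\ infinite_set Y, Y `<=` X &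
  forall y, (y < x)%O -> exists2 A, level p y A & almost_subset Y A].
Proof.
move=> Xinf; apply: contrapT => no.
have [y yx richy] : exists2 y, U y & rich (frozen p y) (refining p y) X.
  by apply: rich_of_not_deep => // Y Yinf YX deep; apply: no; exists Y.
have [By _ /(_ X x richy)[B [Bp BX Bl]]] := px yx.
apply: no; exists B; split=> //; first exact: (By _ Bp).1.
move=> z zx; have [zy|yz] := ltP z y.
  by have [A [? ? _]] := (By _ Bp).2 z zy; exists A.
exists B; last exact: almost_subset_sub.
move: yz; rewrite le_eqVlt => /predU1P[<-|yz]; first by left.
by right; exists y; rewrite Bl; split=> //; exact: ltW.
Qed.

Lemma refining_dense X : infinite_set X ->
  exists B, [/\ refining p x B, infinite_set B & B `<=` X].
Proof.
move=> /deep_dense[Y [Yinf YX Ydeep]].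
(* Either some member above [Y] stays in all later levels before [x], and one [R]-step below it,
   taken inside [Y], suffices; or every member above [Y] is replaced before [x], and these
   replacements have already made the [R]-steps, so [Y] itself works. *)
have [[y [A [yx Ay YA Alast]]]|nolast] := pselect (exists y A,
    [/\ (y < x)%O, level p y A, almost_subset Y A &
        forall z, (y <= z)%O -> (z < x)%O -> level p z A]).
  have [B [RAB Binf BY]] := R_dense Yinf YA.
  have BA : almost_subset B A.
    by apply: almost_subset_trans YA; exact: almost_subset_sub.
  exists B; split=> //; last exact: subset_trans YX.
  split=> // z zx; have [yz|zy] := leP y z.
    by exists A; split=> //; exact: Alast.
  have [b [yb Ab alive]] := level_birth Ay.
  have [zb|bz] := ltP z b.
    have [C [Cz AC RCA]] := born_below px (le_lt_trans yb yx) zb Ab.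
    by exists C; split=> //; [exact: almost_subset_trans AC|exact: R_sub RCA BA].
  by exists A; split=> //; exact: alive bz (ltW zy).
exists Y; split=> //; split=> // y yx.
have [A Ay YA] := Ydeep y yx.
have [z [yz zx Az]] : exists z, [/\ (y <= z)%O, (z < x)%O & ~ level p z A].
  apply: contrapT => no; apply: nolast; exists y, A; split=> // z yz zx.
  by apply: contrapT => Az; apply: no; exists z.
have [C Cz YC] := Ydeep z zx; have [b [bz Cb alive]] := level_birth Cz.
(* [C] must be born after [y]: otherwise it would already be the member [A] above [Y] at level [y],
   which is absent from level [z]. *)
have [yb|byy] := ltP y b.
  have [D [Dy CD RDC]] := born_below px (le_lt_trans bz zx) yb Cb.
  exists D; split=> //; first exact: almost_subset_trans CD.
  exact: R_sub RDC YC.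
exfalso; apply: Az; suff -> : A = C by [].
apply: (almost_disjoint_above (level_mad px yx).1 _ _ Yinf) => //.
exact: alive.
Qed.

Lemma refining_down B B' : refining p x B -> infinite_set B' -> B' `<=` B ->
  refining p x B'.
Proof.
move=> [_ Bref] B'inf /almost_subset_sub BB; split=> // y /Bref[A [Ay BA RAB]].
by exists A; split=> //; [exact: almost_subset_trans BA|exact: R_sub BB].
Qed.

Lemma stage_exists : exists v, stage x p v.
Proof.
have [N [l [? ? ?]]] :=
  labelled_mad_family t0 codeI frozen_ad refining_down refining_dense.
by exists (N, l).
Qed.

End Stage.

Lemma stages_exist : exists p, forall x, stage x p (p x).
Proof.
apply: (well_founded_choice (set0, fun=> t0) T_wf) => [x p q v pq|x p px].
  have fE y : (y <= x)%O -> frozen p y = frozen q y.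
    move=> yx; apply/seteqP; split=> A [z [zy Az l]]; exists z; split=> //.
    - by rewrite -pq//; exact: lt_le_trans yx.
    - by rewrite -pq//; exact: lt_le_trans yx.
    - by rewrite pq//; exact: lt_le_trans yx.
    - by rewrite pq//; exact: lt_le_trans yx.
  have lE y : (y < x)%O -> level p y = level q y.
    by move=> yx; rewrite /level fE ?pq//; exact: ltW.
  have rE : refining p x = refining q x.
    apply/seteqP; split=> B [Binf Br]; split=> // y yx;
      have [A [Ay ? ?]] := Br y yx; exists A; split=> //.
      by rewrite -lE.
    by rewrite lE.
  by rewrite /stage fE// rE.
exact: stage_exists.
Qed.

Lemma step_base_matrix :
  (forall x y, exists2 z, (x < z)%O & (y < z)%O) ->
  (forall (K : set T) (C : T -> set nat) Y, cofinal K -> infinite_set Y ->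
    (forall x, almost_subset Y (C x)) ->
    ~ forall x y, K x -> K y -> (x < y)%O -> R (C x) (C y)) ->
  exists M : T -> set (set nat), base_matrix M.
Proof.
move=> dirT noK; have [p pP] := stages_exist; exists (level p).
have madM x : mad_family (level p x) := level_mad (fun x (_ : setT x) => pP x) I.
have refM x y : (x <= y)%O -> refines (level p y) (level p x).
  exact: (@level_refines p setT (fun _ _ _ _ => I) (fun x _ => pP x) x y I).
(* A set born twice would, at its second birth, be one [R]-step below itself. *)
have birth_eq x y A : (p x).1 A -> (p y).1 A -> x = y.
  have lt_absurd z w : (p z).1 A -> (p w).1 A -> ~ (z < w)%O.
    move=> Az Aw zw; have [ref _ _] := pP w; have [Ainf /(_ z zw)] := ref _ Aw.
    move=> [B [Bz AB RBA]]; apply: (R_irr (A := A)).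
    suff {1}<- : B = A by [].
    by apply: (almost_disjoint_above (madM z).1 Bz _ Ainf AB);
      [left|exact: almost_subset_sub].
  move=> Ax Ay; case: (ltgtP x y) => // [xy|yx].
    by case: (lt_absurd x y).
  by case: (lt_absurd y x).
have notdeep Y : infinite_set Y ->
    ~ forall x, setT x -> exists2 A, level p x A & almost_subset Y A.
  move=> Yinf deep.
  have [C CP] : {C : T -> set nat & forall x, level p x (C x) /\
      almost_subset Y (C x)}.
    apply: (@choice _ _ (fun x A => level p x A /\ almost_subset Y A)) => x.
    by have [A] := deep x I; exists A.
  have Ceq x A : level p x A -> almost_subset Y A -> C x = A.
    move=> Ax YA; apply: (almost_disjoint_above (madM x).1 _ _ Yinf) => //.
      exact: (CP x).1.
    exact: (CP x).2.
  apply: (noK [set x | (p x).1 (C x)] C Y) => //.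
  - move=> x; have [b [bx Cb _]] := level_birth (CP x).1.
    (* Beyond its label [C x] is gone, so the member above [Y] at [z] is a different one, born at
       [x] or later; hence the levels where [C] gives a newborn set are cofinal. *)
    have [z xz lz] := dirT x ((p b).2 (C x)).
    have [b' [bz Cb' alive]] := level_birth (CP z).1.
    exists b'; last first.
      rewrite leNgt; apply/negP => b'x.
      have Czx : C x = C z.
        by apply: Ceq (CP z).2; apply: alive; exact: ltW.
      have bb' : b = b' by apply: (birth_eq _ _ (C x)) => //; rewrite Czx.
      have := (CP z).1; rewrite -Czx => -[Cz|[y [yz Cy zl]]].
        by move: b'x; rewrite -bb' (birth_eq _ _ _ Cb Cz) ltNge (ltW xz).
      by move: zl; rewrite (birth_eq _ _ _ Cy Cb) leNgt lz.
    by rewrite /= (Ceq b' (C z))//; [exact: alive|exact: (CP z).2].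
  - by move=> x; exact: (CP x).2.
  - move=> x y Cx Cy xy; have [ref _ _] := pP y.
    have [_ /(_ x xy)[A [Ax CA RA]]] := ref _ Cy.
    by rewrite (Ceq x A)//; exact: almost_subset_trans (CP y).2 CA.
have base B : infinite_set B ->
    exists x : T, exists2 A, level p x A & almost_subset A B.
  move=> Binf.
  have [//|x _ richx] := @rich_of_not_deep p setT (fun _ _ _ _ => I)
    (fun x _ => pP x) B Binf _.
    by move=> Y Yinf _; exact: notdeep.
  have [_ _ /(_ B x richx)[A [Ax AB _]]] := pP x.
  by exists x, A; [left|exact: almost_subset_sub].
split=> //; split=> // -[F madF Fref].
have [A FA] := mad_family_neq0 madF.
by apply: (notdeep A) => [|x _]; [exact: madF.1.1|exact: Fref].
Qed.

End Matrix.

(** * Splitting, regularity and the two cases *)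

Lemma splits_almost_subset A B B' :
  splits A B' -> almost_subset B' B -> splits A B.
Proof.
move=> [AB' B'A] BB; split.
  by rewrite setIC; apply: almost_subset_infiniteI BB _; rewrite setIC.
by rewrite setDE; apply: almost_subset_infiniteI BB _.
Qed.

Lemma almost_subset_infinite A B :
  almost_subset A B -> infinite_set A -> infinite_set B.
Proof.
move=> AB; rewrite -(setIT A) -(setIT B); exact: almost_subset_infiniteI.
Qed.

Section Regular.
Context (d : Order.disp_t) (T : orderType d) (T_regular : regular_cardinal T).
Implicit Types (x y : T) (K : set T).

Lemma regular_unbounded x : exists y, (x < y)%O.
Proof.
have [_ Tinf reg] := T_regular; apply: contrapT => xmax.
apply: Tinf; apply: card_le_finite (finite_set1 x); apply: reg => y.
exists x => //; rewrite leNgt; apply/negP => xy; apply: xmax; by exists y.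
Qed.

(** Recursion chooses [e x] in [K] above all earlier values; were this impossible, the values at the
    predecessors of [x] would form a cofinal set that is too small. *)
Lemma regular_embed_cofinal K : cofinal K ->
  exists e : T -> T, (forall x, K (e x)) /\ {homo e : x y / (x < y)%O}.
Proof.
move=> cofK; have [[wf card] Tinf reg] := T_regular.
have [t0 _] := infinite_setN0 Tinf.
have [||e eP] := @well_founded_choice T T _ t0
    (fun x p v => K v /\ forall y, (y < x)%O -> (p y < v)%O) wf.
- by move=> x p q v pq [Kv pv]; split=> // y yx; rewrite -pq//; exact: pv.
- move=> x p _; apply: contrapT => no; apply: (card x).
  apply: card_le_trans (card_image_le p _); apply: reg => z.
  have [v Kv zv] := cofK z.
  have [y yx vp] : exists2 y, (y < x)%O & (v <= p y)%O.
    apply: contrapT => no'; apply: no; exists v; split=> // y yx.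
    by rewrite ltNge; apply/negP => vp; apply: no'; exists y.
  by exists (p y); [exists y|exact: le_trans vp].
by exists e; split=> [x|x y xy]; [exact: (eP x).1|exact: (eP y).2].
Qed.

(** A cofinal [K] has the size of [T], while the values of [r] lie in a proper initial segment,
    which is smaller because [T] is a cardinal. *)
Lemma regular_not_injective_bounded K (r : T -> T) x0 : cofinal K ->
  (forall x, K x -> (r x <= x0)%O) -> ~ {in K &, injective r}.
Proof.
have [[_ card] _ reg] := T_regular => cofK rx0 rI.
have [x1 x01] := regular_unbounded x0; apply: (card x1).
apply: card_le_trans (reg K cofK) _; rewrite -(card_le_eql (inj_card_eq rI)).
by apply: subset_card_le => _ [x Kx <-]; exact: le_lt_trans (rx0 x Kx) x01.
Qed.

End Regular.

Lemma card_le_index (S T : Type) (s0 : S) (A : set S) : A #<= [set: T] ->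
  exists s : T -> S, forall a, A a -> exists x, s x = a.
Proof.
move=> /card_leP[f].
have [s sP] : {s : T -> S & forall x, (exists a : A, val (f a) = x) ->
    exists2 a : A, val (f a) = x & val a = s x}.
  apply: (@choice _ _ (fun x b => (exists a : A, val (f a) = x) ->
    exists2 a : A, val (f a) = x & val a = b)) => x.
  have [[a fa]|no] := pselect (exists a : A, val (f a) = x).
    by exists (val a) => _; exists a.
  by exists s0 => /no.
exists s => a Aa; pose a' : A := SigSub (mem_set Aa).
exists (val (f a')); have [|b fb <-] := sP (val (f a')); first by exists a'.
suff -> : b = a' by [].
by apply: (@inj _ _ _ f); rewrite ?in_setT//; exact: val_inj.
Qed.

Theorem mainTheorem3 (d : Order.disp_t) (T : orderType d)
    (T_regular : regular_cardinal T)
    (T_le_continuum : [set: T] #<= [set: set nat])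
    (T_AB : ~ (exists C : T -> set nat, decreasing_chain C) \/
            splitting_number_le T) :
  exists M : T -> set (set nat), base_matrix M.
Proof.
have [[wf _] Tinf _] := T_regular.
have [t0 _] := infinite_setN0 Tinf.
(* Labels are elements of [T]; the bound by the continuum codes them as sets of naturals. *)
have [code /(@in2TT _ _ _) codeI] := pcard_injP T_le_continuum.
have dirT (x y : T) : exists2 z, (x < z)%O & (y < z)%O.
  have [z] := regular_unbounded T_regular (Order.max x y).
  by rewrite gt_max => /andP[xz yz]; exists z.
case: T_AB => [nochain|[S [[_ Ssplit] _] ST]].
  apply: (@step_base_matrix d T (fun A B => almost_ssubset B A) wf t0 code) => //.
  - move=> A B B' [BA AB] BB; split; first exact: almost_subset_trans BA.
    apply: contra_not AB => AB'; exact: almost_subset_trans AB' BB.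
  - by move=> ? [_]; rewrite setDv; apply; exact: finite_set0.
  - move=> A X Xinf XA; have [B [BX Binf XB]] := infinite_set_halve Xinf.
    exists B; split=> //; split.
      by apply: almost_subset_trans XA; exact: almost_subset_sub.
    by rewrite setDE; apply: almost_subset_infiniteI XA _.
  - move=> K C Y cofK _ _ Kchain.
    (* The chain along [K] is reindexed by the whole of [T], as a chain of length [T] is what case
       (A) excludes. *)
    have [e [eK emono]] := regular_embed_cofinal T_regular cofK.
    by apply: nochain; exists (C \o e) => x y xy; apply: Kchain => //; exact: emono.
have [s sS] := card_le_index set0 ST.
have sP A : infinite_set A -> exists2 x : T, splits (s x) A &
    forall y, (y < x)%O -> ~ splits (s y) A.
  move=> /Ssplit[B SB BA]; apply: (well_founded_min wf).
  by have [x sx] := sS B SB; exists x; rewrite sx.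
pose R A B := exists x, [/\ splits (s x) A,
  forall y, (y < x)%O -> ~ splits (s y) A & ~ splits (s x) B].
apply: (@step_base_matrix d T R wf t0 code) => //.
- move=> A B B' [x [xA xmin xB]] BB; exists x; split=> //.
  by apply: contra_not xB => xB'; exact: splits_almost_subset BB.
- by move=> A [x []].
- move=> A X Xinf XA; have [x xA xmin] := sP A (almost_subset_infinite XA Xinf).
  have [XS|XS] := infinite_setI_or (s x) Xinf.
    exists (X `&` s x); split=> //.
    exists x; split=> // -[_]; apply.
    rewrite (_ : _ `\` _ = set0); first exact: finite_set0.
    by rewrite -subset0 => n [[_ sn] /(_ sn)].
  exists (X `\` s x); split=> //.
  exists x; split=> // -[+ _]; apply.
  rewrite (_ : _ `&` _ = set0); first exact: finite_set0.
  by rewrite -subset0 => n [sn [_ /(_ sn)]].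
- move=> K C Y cofK Yinf YC KR.
  (* Let [r x] be the first index whose set splits [C x]. It is at most [x0], since what splits [Y]
     splits [C x], and it is injective on [K], since after an [R]-step the set at [r x] no longer
     splits. This contradicts regularity. *)
  have [x0 x0Y _] := sP Y Yinf.
  have [r rP] : {r & forall x, splits (s (r x)) (C x) /\
      forall y, (y < r x)%O -> ~ splits (s y) (C x)}.
    apply: (@choice _ _ (fun x z => splits (s z) (C x) /\
      forall y, (y < z)%O -> ~ splits (s y) (C x))) => x.
    by have [z] := sP (C x) (almost_subset_infinite (YC x) Yinf); exists z.
  apply: (regular_not_injective_bounded (r := r) (x0 := x0) T_regular cofK).
    move=> x _; rewrite leNgt; apply/negP => /(rP x).2; apply.
    exact: splits_almost_subset (YC x).
  have rneq x y : K x -> K y -> (x < y)%O -> r x <> r y.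
    move=> Kx Ky xy rxy; have [z [zC zmin]] := KR x y Kx Ky xy; apply.
    suff -> : z = r y by exact: (rP y).1.
    rewrite -rxy; case: (ltgtP z (r x)) => // [/(rP x).2//|/zmin].
    by case; exact: (rP x).1.
  move=> x y /set_mem Kx /set_mem Ky rxy; case: (ltgtP x y) => // [xy|yx].
    by case: (rneq x y).
  by case: (rneq y x).
Qed.
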